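(* Let $\Omega$, $k$, $\mathcal{H}_k(\overline{\Omega})$, $\overline{P},\overline{B},L_i^P,L_j^B,f,g$ be as in the context, and suppose that the boundary value problem (PDE) admits at least one solution in $\mathcal{H}_k(\overline{\Omega})$. Let $(X_n)_{n\in\mathbb{N}}$ be a sequence of sets of distinct collocation points $X_n=X_{\Omega,n}\cup X_{\partial\Omega,n}$, where $X_{\Omega,n}=\{x_1^n,\ldots,x_{M_n}^n\}\subset\Omega$ and $X_{\partial\Omega,n}=\{x_1^{n\prime},\ldots,x_{M_n'}^{n\prime}\}\subset\partial\Omega$ are nonempty and finite. Assume that for each $n$ the functionals in $\mathbf{X}(X_n)$ are linearly independent, and that the effective fill distances satisfy $\lim_{n\to\infty}\overline h_{X_n}^{\Omega}=0$. For each $n\in\mathbb{N}$ let $u_n\in\mathcal{H}_k(\overline{\Omega})$ be a minimizer of the optimal recovery problem (OR) corresponding to $X_n$. Then: a) $\operatorname{dist}_{\mathcal{H}_k(\overline{\Omega})}(u_n,S_k)\to 0$ as $n\to\infty$, where $S_k$ is the set of minimum-norm solutions of (PDE). b) If (PDE) admits a unique minimum-norm solution $u^\star\in\mathcal{H}_k(\overline{\Omega})$ (i.e. $S_k=\{u^\star\}$), then $u_n\to u^\star$ in the norm of $\mathcal{H}_k(\overline{\Omega})$.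
   Context: Setting. $\Omega\subset\mathbb{R}^d$ is a bounded open set with (compact) closure $\overline{\Omega}$ and boundary $\partial\Omega$. Let $\ell\in\mathbb{N}$. A positive definite kernel is a symmetric function $k:\overline{\Omega}\times\overline{\Omega}\to\mathbb{R}$ such that all matrices $(k(x_i,x_j))_{i,j=1}^n$, $x_1,\dots,x_n\in\overline{\Omega}$, are positive semi-definite; $\mathcal{H}_k(\overline{\Omega})$ denotes its reproducing kernel Hilbert space of functions $\overline{\Omega}\to\mathbb{R}$. Assume $k\in C^{2\ell}(\overline{\Omega}\times\overline{\Omega})$; then $\mathcal{H}_k(\overline{\Omega})\subset C^\ell(\overline{\Omega})$ and, for $|\alpha|\le\ell$, $\langle\partial_2^\alpha k(\cdot,x),v\rangle_{\mathcal{H}_k(\overline{\Omega})}=\partial^\alpha v(x)$ for all $v\in\mathcal{H}_k(\overline{\Omega})$, $x\in\overline{\Omega}$ ($\partial_2^\alpha$ is differentiation in the second argument; $C^\ell(\overline{\Omega})$ means derivatives up to order $\ell$ extend continuously to $\overline{\Omega}$, and values of derivatives on $\partial\Omega$ are those of the extensions). PDE. For $N\in\mathbb{N}$ write $[N]=\{1,\dots,N\}$. Let $\overline{P}:\mathbb{R}^Q\to\mathbb{R}$ and $\overline{B}:\mathbb{R}^R\to\mathbb{R}$ be continuous, let $L_1^P,\dots,L_Q^P$ and $L_1^B,\dots,L_R^B$ be linear differential operators of order at most $\ell$, i.e. linear combinations (with real constant coefficients) of partial derivatives $\partial^\alpha$, $|\alpha|\le\ell$, and let $f:\Omega\to\mathbb{R}$,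 $g:\partial\Omega\to\mathbb{R}$ be given functions. The problem (PDE) is: $\overline{P}(L_1^Pu(x),\dots,L_Q^Pu(x))=f(x)$ for all $x\in\Omega$, and $\overline{B}(L_1^Bu(x),\dots,L_R^Bu(x))=g(x)$ for all $x\in\partial\Omega$. Minimum-norm solutions. $S_k$ is the set of those solutions $u\in\mathcal{H}_k(\overline{\Omega})$ of (PDE) whose norm $\|u\|_{\mathcal{H}_k(\overline{\Omega})}$ is minimal among all solutions of (PDE) in $\mathcal{H}_k(\overline{\Omega})$. For $u\in\mathcal{H}_k(\overline{\Omega})$, $\operatorname{dist}_{\mathcal{H}_k(\overline{\Omega})}(u,S_k)=\inf_{v\in S_k}\|u-v\|_{\mathcal{H}_k(\overline{\Omega})}$. Collocation. For a finite set $X=\{x_1,\dots,x_M\}\cup\{x_1',\dots,x_{M'}'\}$ with $x_i\in\Omega$, $x_j'\in\partial\Omega$, let $\mathbf{X}(X)=\{\delta_{x_i}^{L_q^P}: i\in[M],q\in[Q]\}\cup\{\delta_{x_j'}^{L_r^B}: j\in[M'],r\in[R]\}$, where $\delta_x^L:\mathcal{H}_k(\overline{\Omega})\to\mathbb{R}$, $\delta_x^L(u)=(Lu)(x)$. The optimal recovery problem (OR) corresponding to $X$ is: minimize $\|u\|_{\mathcal{H}_k(\overline{\Omega})}^2$ over $u\in\mathcal{H}_k(\overline{\Omega})$ subject to $\overline{P}(L_1^Pu(x_i),\dots,L_Q^Pu(x_i))=f(x_i)$ for $i\in[M]$ and $\overline{B}(L_1^Bu(x_j'),\dots,L_R^Bu(x_j'))=g(x_j')$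 for $j\in[M']$. Effective fill distance. For $\Gamma\subset\mathbb{R}^d$ and nonempty finite $Y\subset\Gamma$, $h_Y^\Gamma=\sup_{x\in\Gamma}\inf_{y\in Y}\|x-y\|$. For $X=X_\Omega\cup X_{\partial\Omega}$ with $X_\Omega\subset\Omega$, $X_{\partial\Omega}\subset\partial\Omega$ nonempty and finite, $\overline h_X^\Omega=\max\{h_{X_\Omega}^{\Omega},h_{X_{\partial\Omega}}^{\partial\Omega}\}$. *)

(* Defs.v *)
(* Points of R^d are row vectors 'rV[R]_d.  A function on the closure of an open set U is represented by a
   total function 'rV[R]_d -> R of which only the values on closure U matter. *)
From HB Require Import structures.
From mathcomp Require Import all_boot all_order all_algebra.
From mathcomp Require Import all_classical all_reals all_analysis.

Set Implicit Arguments.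
Unset Strict Implicit.
Unset Printing Implicit Defensive.

Import Order.TTheory GRing.Theory Num.Theory numFieldNormedType.Exports.
Local Open Scope classical_set_scope.
Local Open Scope ring_scope.

Section Topology.
Context {R : realType} {d : nat}.

Definition frontier (A : set 'rV[R]_d) : set 'rV[R]_d :=
  closure A `\` interior A.

(* The library norm on 'rV[R]_d is the sup norm, which induces the same
   topology and the same bounded sets but not the same distances. *)
Definition enorm (x : 'rV[R]_d) : R := Num.sqrt (\sum_i x 0 i ^+ 2).

(* Extended-real valued, so that no convention is needed for sup and inf. *)
Definition fill_distance (G Y : set 'rV[R]_d) : \bar R :=
  ereal_sup [set ereal_inf [set (enorm (x - y))%:E | y in Y] | x in G].

Definition effective_fill_distance (Om XO XB : set 'rV[R]_d) : \bar R :=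
  maxe (fill_distance Om XO) (fill_distance (frontier Om) XB).

End Topology.

Section Derivatives.
Context {R : realType}.

(* iter_partial [:: i1; ...; im] f is d_{i1} (... (d_{im} f)). *)
Definition iter_partial (d : nat) (s : seq 'I_d) (f : 'rV[R]_d -> R) :
    'rV[R]_d -> R :=
  foldr (fun i g x => 'D_(delta_mx 0 i) g x) f s.

(* f is in C^m(closure U), for U open: all iterated partial derivatives of
   order at most m exist on U and extend continuously to closure U, the one of
   order 0 being extended by f itself.  Continuity on U follows from the
   continuity of the extension. *)
Definition Cclosure (d m : nat) (U : set 'rV[R]_d) (f : 'rV[R]_d -> R) : Prop :=
  {within closure U, continuous f} /\
  forall s : seq 'I_d, (size s <= m)%N ->
    ((size s < m)%N -> forall x i, U x ->
       derivable (iter_partial s f) x (delta_mx 0 i)) /\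
    (exists2 g : 'rV[R]_d -> R, {within closure U, continuous g} &
       forall x, U x -> g x = iter_partial s f x).

(* A kernel on R^d seen as a function on R^(d + d), and the product U x U. *)
Definition uncurry_rV (d : nat) (k : 'rV[R]_d -> 'rV[R]_d -> R) :
    'rV[R]_(d + d) -> R :=
  fun z => k (lsubmx z) (rsubmx z).

Definition square_rV (d : nat) (U : set 'rV[R]_d) : set 'rV[R]_(d + d) :=
  [set z | U (lsubmx z) /\ U (rsubmx z)].

(* Multi-indices with entries at most l; |alpha| <= l is imposed separately. *)
Definition multi_index (d l : nat) := {ffun 'I_d -> 'I_l.+1}.

Definition mi_order (d l : nat) (alpha : multi_index d l) : nat :=
  (\sum_i alpha i)%N.

Definition partial (d l : nat) (alpha : multi_index d l)
    (f : 'rV[R]_d -> R) : 'rV[R]_d -> R :=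
  iter_partial (flatten [seq nseq (alpha i) i | i <- enum 'I_d]) f.

(* On the boundary, the value of a derivative is that of its continuous
   extension, i.e. its limit from within U. *)
Definition partial_closure (d l : nat) (U : set 'rV[R]_d)
    (alpha : multi_index d l) (f : 'rV[R]_d -> R) (x : 'rV[R]_d) : R :=
  if x \in U then partial alpha f x
  else lim (partial alpha f y @[y --> within U (nbhs x)]).

(* The operator sum_{|alpha| <= l} a_alpha d^alpha, given by its coefficients
   (those with |alpha| > l are ignored). *)
Definition diffop (d l : nat) := multi_index d l -> R.

Definition apply_op (d l : nat) (U : set 'rV[R]_d) (L : diffop d l)
    (f : 'rV[R]_d -> R) (x : 'rV[R]_d) : R :=
  \sum_(alpha : multi_index d l | (mi_order alpha <= l)%N)
    L alpha * partial_closure U alpha f x.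

End Derivatives.

Arguments diffop : clear implicits.

Section RKHS.
Context {R : realType} {T : Type}.

Definition positive_definite_kernel (D : set T) (k : T -> T -> R) : Prop :=
  (forall x y, D x -> D y -> k x y = k y x) /\
  (forall (n : nat) (x : 'I_n -> T), (forall i, D (x i)) ->
     forall c : 'rV[R]_n,
       0 <= (c *m (\matrix_(i, j) k (x i) (x j)) *m c^T) 0 0).

(* The Hilbert space of functions on D with reproducing kernel k.  rk_fun
   sends an element to the function on D that it is; rk_inj expresses that an
   element is nothing more than this function.  By the Moore-Aronszajn theorem
   such a space exists for every positive definite kernel and is unique. *)
Record rkhs (D : set T) (k : T -> T -> R) := Rkhs {
  rk_space :> completeNormedModType R;
  rk_dot : {dot rk_space for idfun};
  rk_norm : forall u : rk_space, `|u| = Num.sqrt (rk_dot u u);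
  rk_fun : rk_space -> T -> R;
  rk_linear : forall (a : R) (u v : rk_space) (x : T), D x ->
    rk_fun (a *: u + v) x = a * rk_fun u x + rk_fun v x;
  rk_inj : forall u v : rk_space,
    (forall x, D x -> rk_fun u x = rk_fun v x) -> u = v;
  rk_section : T -> rk_space;
  rk_sectionE : forall x y, D x -> D y -> rk_fun (rk_section x) y = k y x;
  rk_reproducing : forall (u : rk_space) x, D x ->
    rk_dot (rk_section x) u = rk_fun u x
}.

End RKHS.

Section Functionals.
Context {R : realType}.

Definition dist_to_set (H : normedModType R) (u : H) (S : set H) : \bar R :=
  ereal_inf [set (`|u - v|)%:E | v in S].

Definition lin_indep (H : Type) (F : set (H -> R)) : Prop :=
  forall (n : nat) (phi : 'I_n -> H -> R) (c : 'I_n -> R),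
    injective phi -> (forall i, F (phi i)) ->
    (forall u, \sum_i c i * phi i u = 0) -> forall i, c i = 0.

End Functionals.

(* Data of a boundary value problem on Om: f is only evaluated on Om, and g
   only on its boundary. *)
Record bvp (R : realType) (d l : nat) := Bvp {
  pde_dim : nat;
  bnd_dim : nat;
  pde_fun : 'rV[R]_pde_dim -> R;
  bnd_fun : 'rV[R]_bnd_dim -> R;
  pde_op : 'I_pde_dim -> diffop R d l;
  bnd_op : 'I_bnd_dim -> diffop R d l;
  pde_rhs : 'rV[R]_d -> R;
  bnd_rhs : 'rV[R]_d -> R
}.

Arguments pde_fun {R d l} _.
Arguments bnd_fun {R d l} _.
Arguments pde_op {R d l} _.
Arguments bnd_op {R d l} _.
Arguments pde_rhs {R d l} _.
Arguments bnd_rhs {R d l} _.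

Section Problem.
Context {R : realType} {d l : nat} (Om : set 'rV[R]_d)
  {k : 'rV[R]_d -> 'rV[R]_d -> R} (H : rkhs (closure Om) k) (p : bvp R d l).

Definition delta_op (x : 'rV[R]_d) (L : diffop R d l) : H -> R :=
  fun u => apply_op Om L (rk_fun u) x.

(* u satisfies the equation at the points of A and the boundary condition at
   the points of B. *)
Definition satisfies (A B : set 'rV[R]_d) (u : H) : Prop :=
  (forall x, A x ->
     pde_fun p (\row_q delta_op x (pde_op p q) u) = pde_rhs p x) /\
  (forall x, B x ->
     bnd_fun p (\row_r delta_op x (bnd_op p r) u) = bnd_rhs p x).

Definition pde_solution (u : H) : Prop := satisfies Om (frontier Om) u.

Definition min_norm_solutions : set H :=
  [set u | pde_solution u /\ forall v, pde_solution v -> `|u| <= `|v|].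

Definition collocation_functionals (XO XB : set 'rV[R]_d) : set (H -> R) :=
  [set phi | exists x q, XO x /\ phi = delta_op x (pde_op p q)] `|`
  [set phi | exists x r, XB x /\ phi = delta_op x (bnd_op p r)].

Definition or_minimizer (XO XB : set 'rV[R]_d) (u : H) : Prop :=
  satisfies XO XB u /\
  forall v, satisfies XO XB v -> `|u| ^+ 2 <= `|v| ^+ 2.

End Problem.

Arguments min_norm_solutions {R d l Om k} H p.
Arguments collocation_functionals {R d l Om k} H p XO XB.

(* Main.v *)
Require Import Defs.
From HB Require Import structures.
From mathcomp Require Import all_boot all_order all_algebra.
From mathcomp Require Import all_classical all_reals all_analysis.
From mathcomp Require Import ring lra.

Set Implicit Arguments.
Unset Strict Implicit.
Unset Printing Implicit Defensive.

Import Order.TTheory GRing.Theory Num.Theory numFieldNormedType.Exports.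
Local Open Scope classical_set_scope.
Local Open Scope ring_scope.

(** The theorem rests on two facts.

    Derivatives of order at most [l] are represented in [H] by vectors that
    depend continuously, in norm, on the point, up to the boundary. These
    vectors are the derivatives of the feature map [x |-> k(., x)] itself, taken
    in [H]. Both their existence and their limits at the boundary come from
    Loeve's criterion ([loeve]): a family [f] in a Hilbert space converges as
    soon as the numbers [<f s, f t>] converge when [s] and [t] vary
    independently. For difference quotients of the feature map those numbers are
    mixed second difference quotients of derivatives of [k]
    ([mixed_difference]), and for limits at the boundary they are derivatives of
    [k] near the diagonal; so [2 l] derivatives of the kernel give [l]
    derivatives of the feature map ([feature_derivP], [cvg_feature_deriv]), and
    every operator [L] has a continuous representer ([op_repr]).

    Bounded families in [H] converge weakly along every ultrafilter
    ([weakly_compact_ball]), by compactness of intervals and Riesz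
    representation. The minimizers [u_n] are bounded by the norm of any solution
    of the boundary value problem, because a solution is feasible for every
    collocation problem. Let [w] be their weak limit along an ultrafilter
    refining [n -> oo]. A point [x] of the domain or of its boundary is a limit
    of collocation points [y_n], and [L u_n (y_n) = <op_repr L y_n, u_n>]
    converges to [L w (x)], a strongly convergent sequence being paired with a
    weakly convergent one; so [w] solves the boundary value problem
    ([equation_weak_limit]). Weak limits do not increase the norm, so [w] has
    minimal norm, and [|u_n| <= |w|] turns weak into strong convergence
    ([or_minimizers_cvg_ultra]). Thus along every ultrafilter [u_n] converges in
    norm to some minimum-norm solution, which is what both claims say
    ([cvg_ultra]). *)

(** * Hilbert spaces *)

Section HilbertSpace.
Context {R : realType} {V : completeNormedModType R}.
Variable dot : {dot V for idfun}.
Hypothesis normE : forall u : V, `|u| = Num.sqrt (dot u u).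

Lemma dotC u v : dot u v = dot v u.
Proof. by rewrite [LHS]hermitian_subproof expr0 mul1r. Qed.

Lemma dotDl u v w : dot (u + v) w = dot u w + dot v w.
Proof. exact: linearDl. Qed.

Lemma dotBl u v w : dot (u - v) w = dot u w - dot v w.
Proof. exact: linearBl. Qed.

Lemma dotDr u v w : dot w (u + v) = dot w u + dot w v.
Proof. exact: linearDr. Qed.

Lemma dotBr u v w : dot w (u - v) = dot w u - dot w v.
Proof. exact: linearBr. Qed.

Lemma dotZl a u v : dot (a *: u) v = a * dot u v.
Proof. exact: linearZl_LR. Qed.

Lemma dotZr a u v : dot u (a *: v) = a * dot u v.
Proof. by rewrite dotC dotZl dotC. Qed.

Lemma dot_suml (I : Type) (r : seq I) (P : pred I) (F : I -> V) v :
  dot (\sum_(i <- r | P i) F i) v = \sum_(i <- r | P i) dot (F i) v.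
Proof. exact: linear_sumlz. Qed.

Lemma dot_ge0 u : 0 <= dot u u.
Proof.
have [->|/neq0_dnorm_gt0/ltW//] := eqVneq u 0.
by rewrite linear0l.
Qed.

Lemma sqr_norm u : `|u| ^+ 2 = dot u u.
Proof. by rewrite normE sqr_sqrtr// dot_ge0. Qed.

Lemma sqr_normD u v : `|u + v| ^+ 2 = `|u| ^+ 2 + 2 * dot u v + `|v| ^+ 2.
Proof. by rewrite !sqr_norm dotDl !dotDr (dotC v u); ring. Qed.

Lemma sqr_normB u v : `|u - v| ^+ 2 = `|u| ^+ 2 - 2 * dot u v + `|v| ^+ 2.
Proof. by rewrite !sqr_norm dotBl !dotBr (dotC v u); ring. Qed.

Lemma dot_le_norm u v : dot u v <= `|u| * `|v|.
Proof.
have := sqr_normD u v.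
have : `|u + v| ^+ 2 <= (`|u| + `|v|) ^+ 2.
  by rewrite ler_sqr ?nnegrE ?addr_ge0// ler_normD.
by move: (_ ^+ 2) => a; nra.
Qed.

(** Cauchy-Schwarz, read off from the triangle inequality, which the norm
    satisfies by assumption. *)
Lemma norm_dot_le u v : `|dot u v| <= `|u| * `|v|.
Proof.
rewrite ler_norml dot_le_norm andbT lerNl.
by rewrite -[- dot u v]mulN1r -dotZl scaleN1r -(normrN u) dot_le_norm.
Qed.

Lemma polarization u v :
  dot u v = (`|u + v| ^+ 2 - `|u| ^+ 2 - `|v| ^+ 2) / 2.
Proof. by rewrite sqr_normD; field. Qed.

Lemma cvg_sqr_norm (T : Type) (F : set_system T) {FF : Filter F}
    (f : T -> V) (a : V) :
  f @ F --> a -> `|f t| ^+ 2 @[t --> F] --> `|a| ^+ 2.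
Proof. by move=> fa; rewrite expr2; apply: cvgM; exact: cvg_norm. Qed.

Lemma cvg_dot (T : Type) (F : set_system T) {FF : Filter F}
    (f g : T -> V) (a b : V) :
  f @ F --> a -> g @ F --> b -> dot (f t) (g t) @[t --> F] --> dot a b.
Proof.
move=> fa gb; rewrite polarization; under eq_fun do rewrite polarization.
apply: cvgM; last exact: cvg_cst.
by apply: cvgB; [apply: cvgB|]; apply: cvg_sqr_norm => //; exact: cvgD.
Qed.

(** The Cauchy-Schwarz inequality and the bound on [g] reduce the claim to the
    weak convergence of [g] against the fixed vector [a]. *)
Lemma cvg_dot_weak (T : Type) (F : set_system T) {FF : Filter F}
    (f g : T -> V) (a b : V) (M : R) :
  (forall t, `|g t| <= M) -> (forall h, dot h (g t) @[t --> F] --> dot h b) ->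
  f @ F --> a -> dot (f t) (g t) @[t --> F] --> dot a b.
Proof.
move=> gM gb fa.
have -> : (fun t => dot (f t) (g t)) =
          (fun t => dot (f t - a) (g t) + dot a (g t)).
  by apply/funext => t; rewrite dotBl subrK.
rewrite -[dot a b]add0r; apply: cvgD; last exact: gb.
apply/norm_cvg0P.
have fa0 : `|f t - a| * M @[t --> F] --> 0.
  rewrite -[X in _ --> X](mul0r M); apply: cvgM; last exact: cvg_cst.
  apply/norm_cvg0P; rewrite -[X in _ --> X](subrr a).
  by apply: cvgB => //; exact: cvg_cst.
apply: squeeze_cvgr (cvg_cst 0) fa0; apply: nearW => t.
rewrite normr_ge0/=; apply: le_trans (norm_dot_le _ _) _.
by rewrite ler_wpM2l.
Qed.

(** Loeve's criterion: inner products that converge along the product filter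
    make the family Cauchy, because [|u - v|^2] is a combination of three of
    them whose limits cancel. *)
Lemma loeve (T : Type) (F : set_system T) {FF : ProperFilter F}
    (f : T -> V) (c : R) :
  (forall e : R, 0 < e -> exists2 A, F A &
     forall s t, A s -> A t -> `|dot (f s) (f t) - c| <= e) ->
  cvg (f @ F).
Proof.
move=> fc; apply/cauchy_cvgP/cauchy_ballP => /= e e0.
have [|A FA Ac] := fc (e ^+ 2 / 8); first by rewrite divr_gt0// exprn_gt0.
have fA : \forall t \near F, (f @` A) (f t).
  by apply: filterS FA => t At; exists t.
exists (f @` A, f @` A) => //.
move=> [_ _] [/= [s As <-] [t At <-]]; rewrite -ball_normE/=.
rewrite -ltr_sqr ?nnegrE ?(ltW e0)// sqr_normB !sqr_norm.
have := Ac _ _ As As; have := Ac _ _ As At; have := Ac _ _ At At.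
rewrite !ler_norml => /andP[? ?] /andP[? ?] /andP[? ?].
have : 0 < e ^+ 2 by rewrite exprn_gt0.
lra.
Qed.

(** Riesz representation: the representer of [phi] minimises
    [|v|^2 - 2 phi v]; minimising sequences are Cauchy by the parallelogram
    identity, and the first-order condition at the minimum says that the
    minimiser represents [phi]. *)
Lemma riesz (phi : V -> R) (M : R) :
  (forall a u v, phi (a *: u + v) = a * phi u + phi v) ->
  (forall u, `|phi u| <= M * `|u|) ->
  exists w, forall h, phi h = dot h w.
Proof.
move=> phiP phiM; pose J v : R := `|v| ^+ 2 - 2 * phi v.
have phi0 : phi 0 = 0.
  by have := phiP 1 0 0; rewrite scaler0 addr0 mul1r => ?; lra.
have phiD u v : phi (u + v) = phi u + phi v.
  by have := phiP 1 u v; rewrite scale1r mul1r.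
have phiZ a u : phi (a *: u) = a * phi u.
  by have := phiP a u 0; rewrite !addr0 phi0 addr0.
have JM v : - M ^+ 2 <= J v.
  rewrite /J; have := phiM v; rewrite ler_norml => /andP[_ ?].
  have := sqr_ge0 (`|v| - M); nra.
pose I := range J; have infI : has_inf I.
  split; first by exists (J 0); exists 0.
  by exists (- M ^+ 2) => _ [v _ <-].
pose m := inf I.
have mJ v : m <= J v by apply: ge_inf; [exact: infI.2|exists v].
have JB a b : `|a - b| ^+ 2 <= 2 * (J a - m) + 2 * (J b - m).
  have := mJ (2^-1 *: (a + b)).
  rewrite /J phiZ phiD normrZ exprMn sqr_normD sqr_normB gtr0_norm ?invr_gt0//.
  by move: (dot a b) (phi a) (phi b) => ? ? ?; lra.
have /choice[v vm] : forall n : nat, exists v, J v < m + n.+1%:R^-1.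
  move=> n; have [|_ [v _ <-] ?] := @inf_adherent _ I n.+1%:R^-1 _ infI.
    by rewrite invr_gt0.
  by exists v.
have /cvg_ex[/= w vw] : cvg (v @ \oo).
  apply/cauchy_cvgP/cauchy_ballP => /= e e0.
  pose A := [set n : nat | n.+1%:R^-1 < e ^+ 2 / 4].
  have oA : \oo A.
    by apply: near_infty_natSinv_lt (PosNum _); rewrite divr_gt0// exprn_gt0.
  have vA : \forall n \near \oo, (v @` A) (v n).
    by apply: filterS oA => n An; exists n.
  exists (v @` A, v @` A) => //.
  move=> [_ _] [/= [i Ai <-] [j Aj <-]]; rewrite -ball_normE/=.
  rewrite -ltr_sqr ?nnegrE ?(ltW e0)//; apply: le_lt_trans (JB _ _) _.
  move: Ai Aj; rewrite /A/=; have := vm i; have := vm j.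
  by move: i.+1%:R^-1 j.+1%:R^-1 => ? ? ? ? ? ?; lra.
have phi_cont : phi (v n) @[n --> \oo] --> phi w.
  apply/cvgrPdist_le => e e0.
  have M1 : 0 < `|M| + 1 by rewrite ltr_wpDl.
  have eM : 0 < e / (`|M| + 1) by rewrite divr_gt0.
  have /cvgrPdist_le/(_ _ eM) := vw; apply: filterS => n.
  rewrite ler_pdivlMr// => wv.
  have -> : phi w - phi (v n) = phi (w - v n).
    by rewrite phiD -[- v n]scaleN1r phiZ mulN1r.
  apply: le_trans (phiM _) (le_trans _ wv); rewrite mulrC ler_wpM2l//.
  by rewrite (le_trans (ler_norm _))// lerDl.
have Jw : J w <= m.
  have Jv : J (v n) @[n --> \oo] --> J w.
    by apply: cvgB; [exact: cvg_sqr_norm|apply: cvgM => //; exact: cvg_cst].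
  have mn : m + n.+1%:R^-1 @[n --> \oo] --> m.
    rewrite -[X in _ --> X]addr0.
    by apply: cvgD; [exact: cvg_cst|exact: cvg_harmonic].
  by apply: ler_cvg_to Jv mn _; apply: nearW => n; exact/ltW/vm.
exists w => h; apply/eqP; rewrite -subr_eq0; set d := _ - _.
(* [w] minimises [J] along the line through [w] directed by [h]. *)
have quad t : 0 <= t ^+ 2 * `|h| ^+ 2 - 2 * t * d.
  have := le_trans Jw (mJ (w + t *: h)).
  rewrite /J phiD phiZ sqr_normD normrZ exprMn real_normK ?num_real// dotZr.
  by rewrite (dotC w h) /d; move: (`|w| ^+ 2) (phi w) => ? ?; lra.
have [h0|h0] := eqVneq (`|h| ^+ 2) 0.
  have := quad d; rewrite h0 mulr0 sub0r => d2.
  by rewrite -sqrf_eq0 eq_le sqr_ge0 andbT expr2; nra.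
have hp : 0 < `|h| ^+ 2 by rewrite lt_neqAle eq_sym h0 sqr_ge0.
(* The quadratic is least at this value of [t]. *)
have := quad (d / `|h| ^+ 2).
have -> : (d / `|h| ^+ 2) ^+ 2 * `|h| ^+ 2 - 2 * (d / `|h| ^+ 2) * d
    = - (d ^+ 2 / `|h| ^+ 2).
  by field; rewrite -sqrf_eq0.
rewrite oppr_ge0 pmulr_lle0 ?invr_gt0// => d2.
by rewrite -sqrf_eq0 eq_le d2 sqr_ge0.
Qed.

(** Weak compactness of balls along an ultrafilter: every [dot h (u t)] lives
    in a compact interval, hence converges, and the limits form a bounded
    linear functional of [h]. *)
Lemma weakly_compact_ball (T : Type) (F : set_system T) (UF : UltraFilter F)
    (u : T -> V) (M : R) :
  (forall t, `|u t| <= M) ->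
  exists w, forall h, dot h (u t) @[t --> F] --> dot h w.
Proof.
move=> uM; have FF : ProperFilter F by exact: ultra_proper.
have bnd h t : `|dot h (u t)| <= M * `|h|.
  by apply: le_trans (norm_dot_le _ _) _; rewrite mulrC ler_wpM2r.
have /choice[phi phiE] : forall h, exists l : R, dot h (u t) @[t --> F] --> l.
  move=> h.
  have hF : \forall t \near F, `[- (M * `|h|), M * `|h|]%classic (dot h (u t)).
    by apply: nearW => t; rewrite /= in_itv/= -ler_norml.
  have [l [_ lcl]] := segment_compact (fmap_proper_filter _ FF) hF.
  exists l => A lA.
  have [//|FA] := @in_ultra_setVsetC _ F ((fun t => dot h (u t)) @^-1` A) UF.
  by have [x [/= nAx Ax]] := lcl (~` A) A FA lA.
have [|h|w wP] := @riesz phi M.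
- move=> a x y.
  apply: (@cvg_unique _ _ (dot (a *: x + y) (u t) @[t --> F])) => //.
    exact: phiE.
  rewrite /=; under eq_fun do rewrite dotDl dotZl.
  by apply: cvgD => //; apply: cvgM => //; exact: cvg_cst.
- have Fh : `|dot h (u t)| @[t --> F] --> `|phi h| by exact: cvg_norm.
  by apply: (cvgr_to_le Fh); apply: nearW => t; exact: bnd.
by exists w => h; rewrite -wP.
Qed.

End HilbertSpace.

(** * Mixed difference quotients *)

Section MixedDifference.
Context {R : realType} {W : normedModType R}.

Lemma is_derive_line (Y : normedModType R) (f : W -> Y) (x v : W) (t : R) :
  derivable f (t *: v + x) v ->
  is_derive t 1 (fun s : R => f (s *: v + x)) ('D_v f (t *: v + x)).
Proof.
move=> fD.
have E : (fun h : R => h^-1 *: (((fun s : R => f (s *: v + x)) \o shift t)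
                                  (h *: (1 : R)) - f (t *: v + x))) =
    (fun h : R => h^-1 *: ((f \o shift (t *: v + x)) (h *: v)
                           - f (t *: v + x))).
  by apply/funext => h; rewrite /= scalerDl addrA [h *: (1 : R)]mulr1.
by split; rewrite ?/derivable ?/derive E.
Qed.

Lemma MVT_sym (f df : R -> R) (h : R) :
  (forall t : R, `|t| <= `|h| -> is_derive t 1 f (df t)) ->
  exists2 t, `|t| <= `|h| & f h - f 0 = h * df t.
Proof.
move=> fdf; have fc a b : (forall t, t \in `[a, b] -> `|t| <= `|h|) ->
    {within `[a, b], continuous f}.
  move=> ab; apply: derivable_within_continuous => t /ab /fdf.
  by case.
have [h0|h0] := leP 0 h.
  have H t : t \in `[0, h] -> `|t| <= `|h|.
    by rewrite in_itv/= => /andP[t0 th]; rewrite !ger0_norm.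
  have fd (t : R) : t \in `]0, h[ -> is_derive t 1 f (df t).
    by move=> th; apply/fdf/H/subset_itv_oo_cc.
  have [c ch ->] := MVT_segment h0 fd (fc _ _ H).
  by exists c; [exact: H|rewrite subr0 mulrC].
have H t : t \in `[h, 0] -> `|t| <= `|h|.
  by rewrite in_itv/= => /andP[th t0]; rewrite !ler0_norm ?lerN2// ltW.
have fd (t : R) : t \in `]h, 0[ -> is_derive t 1 f (df t).
  by move=> th; apply/fdf/H/subset_itv_oo_cc.
have [c ch E] := MVT_segment (ltW h0) fd (fc _ _ H).
by exists c; [exact: H|rewrite -opprB E sub0r mulrN opprK mulrC].
Qed.

(** The second difference quotient tends to the mixed derivative as both
    increments tend to zero independently: two applications of the mean value
    theorem turn the quotient into a value of the mixed derivative at a nearby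
    point. *)
Lemma mixed_difference (F : W -> R) (U : set W) (v w z : W) :
  open U -> U z ->
  (forall x, U x -> derivable F x w) ->
  (forall x, U x -> derivable ('D_w F) x v) ->
  {for z, continuous ('D_v ('D_w F))} ->
  forall e : R, 0 < e -> exists2 r : R, 0 < r &
    forall h k : R, `|h| < r -> `|k| < r -> h != 0 -> k != 0 ->
    `|(h * k)^-1 * (F (k *: w + (h *: v + z)) - F (h *: v + z)
                    - F (k *: w + z) + F z) - 'D_v ('D_w F) z| <= e.
Proof.
move=> oU Uz Fw Fwv cF e e0.
have /nbhs_ballP[r0 /= r00 r0P] : \forall y \near z, U y /\
    `|'D_v ('D_w F) z - 'D_v ('D_w F) y| <= e.
  near=> y; split; near: y; first exact: open_nbhs_nbhs.
  by have /cvgrPdist_le/(_ e e0) := cF.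
have c0 : 0 < `|v| + `|w| + 1 by rewrite ltr_wpDl ?addr_ge0.
(* Displacing [z] by multiples of [v] and [w] with coefficients below this
   radius keeps it in the ball of radius [r0]. *)
exists (r0 / (`|v| + `|w| + 1)); first by rewrite divr_gt0.
move=> h k; rewrite !ltr_pdivlMr// => hr kr hN0 kN0.
have inball (a b : R) : `|a| <= `|h| -> `|b| <= `|k| ->
    ball z r0 (a *: v + (b *: w + z)).
  move=> ah bk; rewrite -ball_normE/= distrC addrA addrK.
  apply: le_lt_trans (ler_normD _ _) _; rewrite !normrZ.
  have [hk|kh] := leP `|k| `|h|.
    apply: le_lt_trans hr; rewrite !mulrDr mulr1 -[leLHS]addr0.
    apply: lerD => //; apply: lerD; apply: ler_wpM2r => //.
    exact: le_trans hk.
  apply: le_lt_trans kr; rewrite !mulrDr mulr1 -[leLHS]addr0.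
  apply: lerD => //; apply: lerD; apply: ler_wpM2r => //.
  exact: le_trans (ltW kh).
have hh : `|h| <= `|h| by [].
have h0 : `|(0 : R)| <= `|h| by rewrite normr0.
pose f (s : R) := F (s *: w + (h *: v + z)) - F (s *: w + z).
pose df (s : R) := 'D_w F (s *: w + (h *: v + z)) - 'D_w F (s *: w + z).
have [|s sk fk] := @MVT_sym f df k.
  move=> t tk; apply: is_deriveB; apply: is_derive_line; apply: Fw.
    by rewrite addrCA; have [] := r0P _ (inball _ _ hh tk).
  by rewrite -[_ + z]add0r -(scale0r v); have [] := r0P _ (inball _ _ h0 tk).
pose g (t : R) := 'D_w F (t *: v + (s *: w + z)).
pose dg (t : R) := 'D_v ('D_w F) (t *: v + (s *: w + z)).
have [|t th gh] := @MVT_sym g dg h.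
  move=> t th; apply: is_derive_line; apply: Fwv.
  by have [] := r0P _ (inball _ _ th sk).
have -> : F (k *: w + (h *: v + z)) - F (h *: v + z) - F (k *: w + z) + F z
    = f k - f 0.
  by rewrite /f !scale0r !add0r; ring.
have dfs : df s = g h - g 0 by rewrite /df /g scale0r add0r addrCA.
rewrite fk dfs gh (mulrA k) (mulrC k) mulrA mulVf ?mulf_neq0// mul1r distrC.
by have [] := r0P _ (inball _ _ th sk).
Unshelve. all: by end_near. Qed.

End MixedDifference.

(** * Derivatives of a Hilbert space valued map and of its Gram kernel *)

Section KernelDerivatives.
Context {R : realType} {V : completeNormedModType R}.
Variable dot : {dot V for idfun}.
Hypothesis normE : forall u : V, `|u| = Num.sqrt (dot u u).

Lemma is_derive_dot (W : normedModType R) (E : W -> V) (x v : W) (u : V) :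
  derivable E x v ->
  is_derive x v (fun y => dot (E y) u) (dot ('D_v E x) u).
Proof.
move=> ED.
have lim_q : h^-1 *: (((fun y => dot (E y) u) \o shift x) (h *: v)
    - dot (E x) u) @[h --> 0^'] --> dot ('D_v E x) u.
  have -> : (fun h => h^-1 *: (((fun y => dot (E y) u) \o shift x) (h *: v)
      - dot (E x) u)) =
      (fun h => dot (h^-1 *: ((E \o shift x) (h *: v) - E x)) u).
    by apply/funext => h; rewrite dotZl dotBl.
  by apply: (cvg_dot normE); [exact: ED|exact: cvg_cst].
split; first by apply/cvg_ex; exists (dot ('D_v E x) u).
exact: cvg_lim.
Qed.

Lemma open_square_rV (d : nat) (U : set 'rV[R]_d) :
  open U -> open (square_rV U).
Proof.
move=> oU.
have -> : square_rV U = lsubmx @^-1` U `&` rsubmx @^-1` U by [].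
apply: openI; apply: open_comp => // z _; apply: differentiable_continuous.
- exact: differentiable_lsubmx.
- exact: differentiable_rsubmx.
Qed.

Lemma square_rV_row_mx (d : nat) (U : set 'rV[R]_d) x y :
  U x -> U y -> square_rV U (row_mx x y).
Proof. by move=> Ux Uy; split; rewrite ?row_mxKl ?row_mxKr. Qed.

Lemma derive_row_mxl (d : nat) (F : 'rV[R]_(d + d) -> R) x y v :
  'D_(row_mx v 0) F (row_mx x y) = 'D_v (fun x' => F (row_mx x' y)) x.
Proof.
have E : (fun h : R => h^-1 *: (((fun x' => F (row_mx x' y)) \o shift x)
    (h *: v) - F (row_mx x y))) =
    (fun h : R => h^-1 *: ((F \o shift (row_mx x y)) (h *: row_mx v 0)
    - F (row_mx x y))).
  by apply/funext => h; rewrite /= scale_row_mx add_row_mx scaler0 add0r.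
by rewrite /derive E.
Qed.

Lemma derive_row_mxr (d : nat) (F : 'rV[R]_(d + d) -> R) x y v :
  'D_(row_mx 0 v) F (row_mx x y) = 'D_v (fun y' => F (row_mx x y')) y.
Proof.
have E : (fun h : R => h^-1 *: (((fun y' => F (row_mx x y')) \o shift y)
    (h *: v) - F (row_mx x y))) =
    (fun h : R => h^-1 *: ((F \o shift (row_mx x y)) (h *: row_mx 0 v)
    - F (row_mx x y))).
  by apply/funext => h; rewrite /= scale_row_mx add_row_mx scaler0 add0r.
by rewrite /derive E.
Qed.

Section Square.
Context {d : nat} (U : set 'rV[R]_d).
Variables (E : 'rV[R]_d -> V) (F : 'rV[R]_(d + d) -> R) (v : 'rV[R]_d).
Hypothesis oU : open U.
Hypothesis FE : forall x y, U x -> U y -> F (row_mx x y) = dot (E x) (E y).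

Local Notation D2 := ('D_(row_mx 0 v) F).
Local Notation D12 := ('D_(row_mx v 0) D2).

(** The difference quotients of [E] converge by Loeve's criterion: their inner
    products are the mixed difference quotients of the kernel [F] on the
    diagonal. *)
Lemma derivable_of_kernel (x : 'rV[R]_d) :
  (forall z, square_rV U z -> derivable F z (row_mx 0 v)) ->
  (forall z, square_rV U z -> derivable D2 z (row_mx v 0)) ->
  U x -> {for row_mx x x, continuous D12} -> derivable E x v.
Proof.
move=> F2 F12 Ux cF; apply: (loeve normE (c := D12 (row_mx x x))) => e e0.
have [r r0 rP] := mixed_difference (open_square_rV oU)
  (square_rV_row_mx Ux Ux) F2 F12 cF e0.
have Uxv : \forall h \near (0 : R)^', U (h *: v + x).
  have cv : h *: v + x @[h --> (0 : R)] --> 0 *: v + x.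
    apply: cvgD; last exact: cvg_cst.
    exact: scalel_continuous.
  rewrite scale0r add0r in cv.
  by apply: (cvg_within_filter (fun h => h != 0) cv); exact: open_nbhs_nbhs.
exists [set h : R | [/\ h != 0, `|h| < r & U (h *: v + x)]].
  near=> h; split; near: h => //.
  - exact: nbhs_dnbhs_neq.
  - by apply: dnbhs0_lt.
move=> h k [hN0 hr Uh] [kN0 kr Uk]; rewrite /= !(dotZl, dotZr).
have := rP h k hr kr hN0 kN0; congr (_ <= _); congr (`|_ - _|).
rewrite !scale_row_mx !add_row_mx !scaler0 !add0r !FE//.
by rewrite invfM -mulrA !(dotBl, dotBr); congr (_ * (_ * _)); ring.
Unshelve. all: by end_near. Qed.

Lemma derive_kernel (x y : 'rV[R]_d) :
  (forall z, U z -> derivable E z v) -> U x -> U y ->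
  D12 (row_mx x y) = dot ('D_v E x) ('D_v E y).
Proof.
move=> ED Ux Uy.
have nU z : U z -> \forall z' \near z, U z'.
  by move=> Uz; apply: open_nbhs_nbhs.
have D2E x' : U x' -> D2 (row_mx x' y) = dot (E x') ('D_v E y).
  move=> Ux'; rewrite dotC.
  rewrite -(@derive_val _ _ _ _ _ _ _ (is_derive_dot (E x') (ED y Uy))).
  rewrite -(@near_eq_derive _ _ _ (fun y' => F (row_mx x' y'))); last first.
    by apply: filterS (nU _ Uy) => y' Uy'; rewrite FE// dotC.
  exact: derive_row_mxr.
rewrite -(@derive_val _ _ _ _ _ _ _ (is_derive_dot ('D_v E y) (ED x Ux))).
rewrite -(@near_eq_derive _ _ _ (fun x' => D2 (row_mx x' y))); last first.
  by apply: filterS (nU _ Ux) => x' Ux'; rewrite D2E.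
exact: (derive_row_mxl D2).
Qed.

End Square.
End KernelDerivatives.

(** * Representers of differential operators *)

Section Representers.
Context {R : realType}.


(** Closeness of [f] to [g x] on the points of [U] near [x] passes to the limit
    at the points of the closure near [x]. *)
Lemma cvg_within_continuous (T : topologicalType) (V : normedModType R)
    (U : set T) (f g : T -> V) :
  (forall x, closure U x -> f @ within U (nbhs x) --> g x) ->
  {within closure U, continuous g}.
Proof.
move=> fg; apply/subspace_continuousP => x Ux.
apply/cvgrPdist_le => e e0.
have /cvgrPdist_le/(_ e e0) := fg x Ux.
rewrite near_withinE => /nbhs_interior xfe.
rewrite near_withinE; apply: filterS xfe => y yfe Uy.
have FF := within_nbhs_proper Uy.
have gf : `|g x - f z| @[z --> within U (nbhs y)] --> `|g x - g y|.
  by apply: cvg_norm; apply: cvgB; [exact: cvg_cst|exact: fg].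
by apply: (cvgr_to_le gf); rewrite near_withinE.
Qed.

Lemma nbhs_diag_row_mx (n : nat) (x : 'rV[R]_n) (A : set 'rV[R]_(n + n)) :
  nbhs (row_mx x x) A ->
  exists2 B, nbhs x B & forall y z, B y -> B z -> A (row_mx y z).
Proof.
move=> [P xP PA].
exists [set y | forall i j, (P i (lshift n j) `&` P i (rshift n j)) (y i j)].
  exists (fun i j => P i (lshift n j) `&` P i (rshift n j)) => // i j.
  have := xP i (lshift n j); have := xP i (rshift n j).
  by rewrite row_mxEl row_mxEr => ? ?; exact: filterI.
move=> y z By Bz; apply: PA => i j.
case: (split_ordP j) => a ->; rewrite ?row_mxEl ?row_mxEr.
- by have [] := By i a.
- by have [] := Bz i a.
Qed.

Lemma Cclosure_continuous (n m : nat) (U : set 'rV[R]_n) (f : 'rV[R]_n -> R)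
    (s : seq 'I_n) (x : 'rV[R]_n) :
  open U -> Cclosure m U f -> (size s <= m)%N -> U x ->
  {for x, continuous (iter_partial s f)}.
Proof.
move=> oU [_ /(_ s) fU] sm Ux; have [_ [g gC gE]] := fU sm.
have Ux' : nbhs x U by exact: open_nbhs_nbhs.
have cUx : (closure U)° x by apply: filterS Ux'; exact: subset_closure.
have gx : g y @[y --> x] --> g x.
  have /subspace_continuousP/(_ x (interior_subset cUx)) := gC.
  by rewrite within_interior.
rewrite /prop_for /continuous_at -gE//.
have eqx : {near x, g =1 iter_partial s f}.
  by apply: filterS Ux' => y; exact: gE.
exact: cvg_trans (near_eq_cvg eqx) gx.
Qed.

Context {d l : nat} (Om : set 'rV[R]_d).
Context {k : 'rV[R]_d -> 'rV[R]_d -> R} (H : rkhs (closure Om) k).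
Hypothesis oOm : open Om.
Hypothesis kC : Cclosure (2 * l) (square_rV Om) (uncurry_rV k).
Let dot := rk_dot H.
Let normE : forall u : H, `|u| = Num.sqrt (dot u u) := @rk_norm _ _ _ _ H.

(** The derivative of the feature map [x |-> k(., x)], taken in the Hilbert
    space: it represents the evaluation of the same derivative. *)
Definition feature_deriv (s : seq 'I_d) : 'rV[R]_d -> H :=
  foldr (fun i (g : 'rV[R]_d -> H) x => 'D_(delta_mx 0 i) g x)
    (@rk_section _ _ _ _ H) s.

(** By induction on the order: the Gram function of the derivatives of order
    [s] is itself a derivative of [k], of order twice as large, so it has one
    more continuous derivative in each argument as long as [size s < l]. *)
Lemma feature_derivP (s : seq 'I_d) : (size s <= l)%N ->
  (exists S : seq 'I_(d + d), size S = (2 * size s)%N /\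
     forall x y, Om x -> Om y ->
       iter_partial S (uncurry_rV k) (row_mx x y) =
       dot (feature_deriv s x) (feature_deriv s y)) /\
  (forall x u, Om x -> dot (feature_deriv s x) u = iter_partial s (rk_fun u) x).
Proof.
elim: s => [_|i s IH sl].
  split; last by move=> x u Omx; exact/rk_reproducing/subset_closure.
  exists [::]; split=> // x y Omx Omy.
  have cOmx := subset_closure Omx; have cOmy := subset_closure Omy.
  by rewrite /= /uncurry_rV row_mxKl row_mxKr rk_reproducing// rk_sectionE.
have [[S [sS SE]] sE] := IH (ltnW sl).
have Sl : (size S < 2 * l)%N by rewrite sS ltn_mul2l.
have rSl : (size (rshift d i :: S) < 2 * l)%N.
  have : (2 * (size s).+1 <= 2 * l)%N by rewrite leq_mul2l.
  by rewrite mulnS /= sS.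
have F2 z : square_rV Om z ->
    derivable (iter_partial S (uncurry_rV k)) z (row_mx 0 (delta_mx 0 i)).
  by move=> Omz; rewrite -delta_mx_rshift; apply: (kC.2 S (ltnW Sl)).1.
have F12 z : square_rV Om z ->
    derivable ('D_(row_mx 0 (delta_mx 0 i)) (iter_partial S (uncurry_rV k)))
      z (row_mx (delta_mx 0 i) 0).
  move=> Omz; rewrite -delta_mx_rshift -delta_mx_lshift.
  by apply: (kC.2 (rshift d i :: S) (ltnW rSl)).1.
have ED x : Om x -> derivable (feature_deriv s) x (delta_mx 0 i).
  move=> Omx; apply: (derivable_of_kernel normE oOm SE F2 F12 Omx).
  rewrite -delta_mx_rshift -delta_mx_lshift.
  apply: (@Cclosure_continuous _ _ _ _ (lshift d i :: rshift d i :: S)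
    (row_mx x x) (open_square_rV oOm) kC rSl).
  exact: square_rV_row_mx.
split.
  exists (lshift d i :: rshift d i :: S); split; first by rewrite /= sS mulnS.
  move=> x y Omx Omy; rewrite /= delta_mx_rshift delta_mx_lshift.
  exact: (derive_kernel normE oOm SE).
move=> x u Omx; rewrite /=.
rewrite -(@derive_val _ _ _ _ _ _ _ (is_derive_dot normE u (ED x Omx))).
apply: near_eq_derive.
have Omx' : nbhs x Om by exact: open_nbhs_nbhs.
by apply: filterS Omx' => y Omy; rewrite sE.
Qed.

(** On the boundary, the limit of [feature_deriv] from within the domain; the
    case distinction is that of [partial_closure]. *)
Definition feature_closure (s : seq 'I_d) (x : 'rV[R]_d) : H :=
  if x \in Om then feature_deriv s x
  else lim (feature_deriv s y @[y --> within Om (nbhs x)]).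

(** The limit at the boundary exists by Loeve's criterion, because the
    derivatives of [k] extend continuously to the point [(x, x)]. *)
Lemma cvg_feature_deriv (s : seq 'I_d) (x : 'rV[R]_d) :
  (size s <= l)%N -> closure Om x ->
  feature_deriv s y @[y --> within Om (nbhs x)] --> feature_closure s x.
Proof.
move=> sl Omx; have FF := within_nbhs_proper Omx.
have [[S [sS SE]] _] := feature_derivP sl.
have Sl : (size S <= 2 * l)%N by rewrite sS leq_mul2l.
have [_ [g gC gE]] := kC.2 S Sl.
have near_diag A : nbhs (row_mx x x) A -> exists2 B, nbhs x B &
    forall y z, B y -> B z -> A (row_mx y z) := @nbhs_diag_row_mx _ x A.
have Om2x : closure (square_rV Om) (row_mx x x).
  move=> A /near_diag[B xB BA]; have [y [Omy By]] := Omx B xB.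
  by exists (row_mx y y); split; [exact: square_rV_row_mx|exact: BA].
have cE : cvg (feature_deriv s y @[y --> within Om (nbhs x)]).
  apply: (loeve normE (c := g (row_mx x x))) => e e0.
  have /subspace_continuousP/(_ _ Om2x) := gC.
  move=> /cvgrPdist_le/(_ e e0); rewrite near_withinE => /near_diag[B xB BA].
  exists (Om `&` B).
    by apply: filterS xB => y By Omy; split.
  move=> y z [Omy By] [Omz Bz].
  have Omyz := square_rV_row_mx Omy Omz.
  rewrite -(SE y z Omy Omz) -(gE _ Omyz) distrC.
  exact: BA By Bz (subset_closure Omyz).
rewrite /feature_closure; case: ifPn => [/set_mem Ux|_]; last exact: cE.
have /cvg_ex[/= w Ew] := cE.
suff <- : w = feature_deriv s x by [].
have Omx' : (Om)° x by exact: open_nbhs_nbhs.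
rewrite within_interior// in Ew.
apply/eqP; rewrite -subr_eq0 -normr_le0; apply/ler_addgt0Pr => e e0.
rewrite add0r; have /cvgrPdist_le/(_ e e0) := Ew.
exact: nbhs_singleton.
Qed.

Lemma dot_feature_closure (s : seq 'I_d) (x : 'rV[R]_d) (u : H) :
  (size s <= l)%N -> closure Om x ->
  dot (feature_closure s x) u =
  if x \in Om then iter_partial s (rk_fun u) x
  else lim (iter_partial s (rk_fun u) y @[y --> within Om (nbhs x)]).
Proof.
move=> sl Omx; have [_ sE] := feature_derivP sl.
have FF := within_nbhs_proper Omx.
case: ifPn => xOm; first by rewrite /feature_closure xOm sE//; exact: set_mem.
have su : dot (feature_deriv s y) u @[y --> within Om (nbhs x)] -->
    dot (feature_closure s x) u.
  by apply: (cvg_dot normE); [exact: cvg_feature_deriv|exact: cvg_cst].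
symmetry; apply: cvg_lim => //; apply: cvg_trans su; apply: near_eq_cvg.
by rewrite near_withinE; apply: nearW => y Omy; rewrite sE.
Qed.

(** The order in which [partial] differentiates. *)
Definition mi_seq (alpha : multi_index d l) : seq 'I_d :=
  flatten [seq nseq (alpha i) i | i <- enum 'I_d].

Lemma size_mi_seq (alpha : multi_index d l) :
  size (mi_seq alpha) = mi_order alpha.
Proof.
rewrite /mi_seq size_flatten /shape -map_comp sumnE big_map big_enum /=.
by apply: eq_bigr => i _; rewrite size_nseq.
Qed.

(** The Riesz representer of the functional [delta_op x L]. *)
Definition op_repr (L : diffop R d l) (x : 'rV[R]_d) : H :=
  \sum_(alpha : multi_index d l | (mi_order alpha <= l)%N)
    L alpha *: feature_closure (mi_seq alpha) x.

Lemma dot_op_repr (L : diffop R d l) (x : 'rV[R]_d) (u : H) :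
  closure Om x -> dot (op_repr L x) u = delta_op x L u.
Proof.
move=> Omx; rewrite dot_suml; apply: eq_bigr => alpha al.
by rewrite dotZl dot_feature_closure ?size_mi_seq.
Qed.

Lemma op_repr_continuous (L : diffop R d l) :
  {within closure Om, continuous (op_repr L)}.
Proof.
apply: (@cvg_within_continuous _ _ _ (fun x =>
  \sum_(alpha : multi_index d l | (mi_order alpha <= l)%N)
    L alpha *: feature_deriv (mi_seq alpha) x)) => x Omx.
have FF := within_nbhs_proper Omx.
apply: cvg_big => [|alpha al]; first exact: add_continuous.
apply: cvgZl_tmp; apply: cvg_feature_deriv => //.
by rewrite size_mi_seq.
Qed.

End Representers.

(** * Limits of collocation solutions *)

Section Limits.
Context {R : realType}.

(** Convergence can be tested along the ultrafilters refining a filter: a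
    neighbourhood that [f] misses frequently is missed on a set of some such
    ultrafilter. *)
Lemma cvg_ultra (T : Type) (Y : topologicalType) (F : set_system T)
    (f : T -> Y) (y : Y) :
  Filter F ->
  (forall U : set_system T, UltraFilter U -> F `<=` U -> f @ U --> y) ->
  f @ F --> y.
Proof.
move=> FF fU A yA; suff : F (f @^-1` A) by [].
apply: contrapT => nFA.
pose B := f @^-1` (~` A).
have FB : ProperFilter (within B F).
  apply: Build_ProperFilter_ex => P FBP.
  have FP : \forall t \near F, B t -> P t by exact: FBP.
  apply: contrapT => nP; apply: nFA; apply: filterS FP => t BP /=.
  apply: contrapT => nAt.
  by apply: nP; exists t; exact: BP.
have [U [UU FU]] := ultraFilterLemma FB.
have PU : ProperFilter U by exact: ultra_proper.
have UB : U B by apply: FU; exact: withinT.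
have FleU : F `<=` U.
  by move=> P FP; apply: FU; apply: (filterS _ FP) => t Pt _.
have UA : U (f @^-1` A) := fU U UU FleU A yA.
have [t [Bt At]] := filter_ex (filterI UB UA).
exact: Bt.
Qed.

Lemma cvg_row (T : Type) (F : set_system T) {FF : Filter F} (m : nat)
    (f : 'I_m -> T -> R) (l : 'I_m -> R) :
  (forall q, f q t @[t --> F] --> l q) ->
  \row_q f q t @[t --> F] --> \row_q l q.
Proof.
move=> fl A [P lP PA].
have FP : \forall t \near F, forall j, P 0 j (f j t).
  apply: filter_forall => j; apply: fl.
  by have := lP 0 j; rewrite mxE.
apply: filterS FP => t Pt; apply: PA => i j.
by rewrite (ord1 i) mxE.
Qed.

Lemma ball_enorm (d : nat) (x y : 'rV[R]_d) (e : R) :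
  enorm (x - y) < e -> ball x e y.
Proof.
move=> xye; split; first by apply: le_lt_trans xye; exact: sqrtr_ge0.
move=> i j; rewrite (ord1 i) -ball_normE/=; apply: le_lt_trans xye.
rewrite -sqrtr_sqr ler_sqrt ?sumr_ge0// => [|q _]; last exact: sqr_ge0.
rewrite (bigD1 j)//= !mxE lerDl sumr_ge0// => q _; exact: sqr_ge0.
Qed.

(** The points [y n] are chosen closest to [x] in [Y n] up to [1 / (n + 1)]. *)
Lemma fill_distance_cvg (d : nat) (G : set 'rV[R]_d)
    (Y : nat -> set 'rV[R]_d) (x : 'rV[R]_d) :
  (forall n, Y n !=set0) ->
  (forall e : R, 0 < e ->
    \forall n \near \oo, (fill_distance G (Y n) < e%:E)%E) ->
  G x ->
  exists2 y : nat -> 'rV[R]_d, (forall n, Y n (y n)) & y @ \oo --> x.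
Proof.
move=> Y0 fillY Gx.
pose S n := [set (enorm (x - y))%:E | y in Y n].
have S_ge0 n : (0 <= ereal_inf (S n))%E.
  by apply: le_ereal_inf_tmp => _ [y _ <-]; rewrite lee_fin sqrtr_ge0.
have S_fin n : ereal_inf (S n) \is a fin_num.
  rewrite ge0_fin_numE//; have [y Yy] := Y0 n.
  apply: le_lt_trans (ltry (enorm (x - y))).
  by apply: ereal_inf_lbound; exists y.
have /choice[y yP] : forall n, exists y, Y n y /\
    ((enorm (x - y))%:E < ereal_inf (S n) + (n.+1%:R^-1)%:E)%E.
  move=> n; have n0 : (0 : R) < n.+1%:R^-1 by rewrite invr_gt0.
  by have [_ [y Yy <-] yS] := lb_ereal_inf_adherent n0 (S_fin n); exists y.
exists y; first by move=> n; have [] := yP n.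
apply/cvg_ballP => e e0; have e2 : 0 < e / 2 by rewrite divr_gt0.
near=> n; apply: ball_enorm; rewrite -lte_fin.
apply: lt_trans (yP n).2 _; rewrite [e]splitr EFinD; apply: lteD.
  apply: le_lt_trans (_ : fill_distance G (Y n) < _)%E; last first.
    by near: n; exact: fillY.
  by apply: ereal_sup_ubound; exists x.
rewrite lte_fin; near: n.
exact: near_infty_natSinv_lt (PosNum e2).
Unshelve. all: by end_near. Qed.

End Limits.

Section Collocation.
Context {R : realType} {d l : nat} (Om : set 'rV[R]_d).
Context {k : 'rV[R]_d -> 'rV[R]_d -> R} (H : rkhs (closure Om) k).
Hypothesis oOm : open Om.
Hypothesis kC : Cclosure (2 * l) (square_rV Om) (uncurry_rV k).
Let dot := rk_dot H.
Let normE : forall u : H, `|u| = Num.sqrt (dot u u) := @rk_norm _ _ _ _ H.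

(** Both factors move in [<op_repr L y_n, u_n>]: the representer strongly, by
    its continuity up to the boundary, and [u_n] weakly. *)
Lemma cvg_delta_op (T : Type) (F : set_system T) {FF : Filter F}
    (L : diffop R d l) (u : T -> H) (w : H) (M : R)
    (y : T -> 'rV[R]_d) (x : 'rV[R]_d) :
  (forall t, `|u t| <= M) -> (forall h, dot h (u t) @[t --> F] --> dot h w) ->
  (forall t, closure Om (y t)) -> closure Om x -> y @ F --> x ->
  delta_op (y t) L (u t) @[t --> F] --> delta_op x L w.
Proof.
move=> uM uw Oy Ox yx.
rewrite -(dot_op_repr oOm kC)//.
under eq_fun do rewrite -(dot_op_repr oOm kC)//.
apply: (cvg_dot_weak normE uM uw).
have /subspace_continuousP/(_ x Ox) := @op_repr_continuous _ _ _ _ _ H oOm kC L.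
apply: cvg_comp => A; rewrite /within/= => xA.
have yA : \forall t \near F, closure Om (y t) -> A (y t) := yx _ xA.
by apply: filterS yA => t; apply.
Qed.

(** Both sides are followed along collocation points [y n] tending to [x]. The
    right-hand side [rhs (y n)] tends to [rhs x] because [v] is a solution, so
    that [rhs] is the continuous image of the derivatives of [v]. *)
Lemma equation_weak_limit (F : set_system nat) {FF : ProperFilter F} (m : nat)
    (op : 'I_m -> diffop R d l) (phi : 'rV[R]_m -> R) (rhs : 'rV[R]_d -> R)
    (D : set 'rV[R]_d) (Y : nat -> set 'rV[R]_d)
    (u : nat -> H) (v w : H) (M : R) :
  \oo `<=` F -> continuous phi -> D `<=` closure Om ->
  (forall n, Y n !=set0) -> (forall n, Y n `<=` D) ->
  (forall e : R, 0 < e ->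
    \forall n \near \oo, (fill_distance D (Y n) < e%:E)%E) ->
  (forall n, `|u n| <= M) -> (forall h, dot h (u n) @[n --> F] --> dot h w) ->
  (forall x, D x -> phi (\row_q delta_op x (op q) v) = rhs x) ->
  (forall n x, Y n x -> phi (\row_q delta_op x (op q) (u n)) = rhs x) ->
  forall x, D x -> phi (\row_q delta_op x (op q) w) = rhs x.
Proof.
move=> ooF cphi Dcl Y0 YD fillY uM uw vP uP x Dx.
have [y Yy yx] := fill_distance_cvg Y0 fillY Dx.
have yF : y @ F --> x by move=> A /yx; exact: ooF.
have Oy n : closure Om (y n) by apply/Dcl/YD/Yy.
have Ox := Dcl _ Dx.
have lim_u : phi (\row_q delta_op (y n) (op q) (u n)) @[n --> F] -->
    phi (\row_q delta_op x (op q) w).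
  apply: continuous_cvg; first exact: cphi.
  apply: cvg_row => q; exact: (cvg_delta_op uM uw Oy Ox yF).
have lim_v : phi (\row_q delta_op (y n) (op q) v) @[n --> F] -->
    phi (\row_q delta_op x (op q) v).
  apply: continuous_cvg; first exact: cphi.
  apply: cvg_row => q.
  apply: (@cvg_delta_op _ _ _ _ (fun=> v) v `|v| y x) => // h.
  exact: cvg_cst.
rewrite -vP//; apply: cvg_unique lim_u _ => //.
have -> : (fun n => phi (\row_q delta_op (y n) (op q) (u n))) =
    (fun n => phi (\row_q delta_op (y n) (op q) v)).
  by apply/funext => n; rewrite (uP n) ?vP//; exact/YD.
exact: lim_v.
Qed.

(** A solution is feasible for every collocation problem, so its norm bounds
    those of the minimizers. Applied to an arbitrary solution this shows that
    the weak limit [w] has minimal norm; applied to [w] it gives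
    [|u_n - w|^2 <= 2 |w|^2 - 2 <w, u_n>], which tends to zero. *)
Lemma or_minimizers_cvg_ultra (p : bvp R d l) (XO XB : nat -> set 'rV[R]_d)
    (u : nat -> H) (v : H) (F : set_system nat) (UF : UltraFilter F) :
  \oo `<=` F ->
  continuous (pde_fun p) -> continuous (bnd_fun p) -> pde_solution p v ->
  (forall n, XO n !=set0 /\ XO n `<=` Om) ->
  (forall n, XB n !=set0 /\ XB n `<=` frontier Om) ->
  effective_fill_distance Om (XO n) (XB n) @[n --> \oo] --> 0%E ->
  (forall n, or_minimizer p (XO n) (XB n) (u n)) ->
  exists2 w, min_norm_solutions H p w & u @ F --> w.
Proof.
move=> ooF cP cB vsol XO_ XB_ fillX umin.
have FF : ProperFilter F by exact: ultra_proper.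
have le_sol (s : H) n : pde_solution p s -> `|u n| <= `|s|.
  move=> [sO sB]; rewrite -ler_sqr ?nnegrE//; apply: (umin n).2.
  by split=> x ?; [apply/sO/(XO_ n).2|apply/sB/(XB_ n).2].
have uM n := le_sol v n vsol.
have [w uw] := weakly_compact_ball normE UF uM.
have fill_lt (e : R) : 0 < e ->
    \forall n \near \oo, (effective_fill_distance Om (XO n) (XB n) < e%:E)%E.
  move=> e0; have nbhs_e : nbhs (0%E : \bar R) [set r | (r < e%:E)%E].
    apply: open_nbhs_nbhs; split; first exact: open_ereal_lt_ereal.
    by rewrite /= lte_fin.
  exact: fillX nbhs_e.
have wsol : pde_solution p w.
  split.
  - apply: (equation_weak_limit (v := v) ooF cP _ _ _ _ uM uw).
    + exact: subset_closure.
    + by move=> n; exact: (XO_ n).1.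
    + by move=> n; exact: (XO_ n).2.
    + move=> e /fill_lt; apply: filterS => n.
      by rewrite /effective_fill_distance gt_max => /andP[].
    + exact: vsol.1.
    + by move=> n; exact: (umin n).1.1.
  - apply: (equation_weak_limit (v := v) ooF cB _ _ _ _ uM uw).
    + by move=> x [].
    + by move=> n; exact: (XB_ n).1.
    + by move=> n; exact: (XB_ n).2.
    + move=> e /fill_lt; apply: filterS => n.
      by rewrite /effective_fill_distance gt_max => /andP[].
    + exact: vsol.2.
    + by move=> n; exact: (umin n).1.2.
exists w.
  split=> // s ssol.
  have [->|w0] := eqVneq w 0; first by rewrite normr0.
  rewrite -(@ler_pM2l _ `|w|) ?normr_gt0// -expr2 (sqr_norm normE).
  apply: (cvgr_to_le (uw w)); apply: nearW => n.
  by apply: le_trans (dot_le_norm normE _ _) _; rewrite ler_wpM2l// le_sol.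
have sqr0 : `|u n - w| ^+ 2 @[n --> F] --> 0.
  have up : 2 * `|w| ^+ 2 - 2 * dot w (u n) @[n --> F] -->
      2 * `|w| ^+ 2 - 2 * dot w w.
    apply: cvgB; first exact: cvg_cst.
    by apply: cvgM => //; exact: cvg_cst.
  rewrite -(sqr_norm normE) subrr in up.
  apply: squeeze_cvgr (cvg_cst 0) up; apply: nearW => n.
  rewrite sqr_ge0 (sqr_normB normE) (dotC _ w) /=.
  have : `|u n| ^+ 2 <= `|w| ^+ 2 by rewrite ler_sqr ?nnegrE ?le_sol.
  by rewrite -/dot; move: (dot w (u n)) (_ ^+ 2) (_ ^+ 2) => ? ? ? ?; lra.
apply/cvgrPdist_lt => e e0.
have e2 : 0 < e ^+ 2 by rewrite exprn_gt0.
have sqr_lt : \forall n \near F, `|u n - w| ^+ 2 < e ^+ 2.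
  exact: cvgr_lt sqr0 _ e2.
apply: filterS sqr_lt => n.
by rewrite distrC ltr_sqr ?nnegrE// ltW.
Qed.

End Collocation.

Theorem theorem4p3 (R : realType) (d l : nat) (Om : set 'rV[R]_d)
    (k : 'rV[R]_d -> 'rV[R]_d -> R) (H : rkhs (closure Om) k)
    (p : bvp R d l)
    (XO XB : nat -> set 'rV[R]_d) (u : nat -> H) :
  open Om -> bounded_set Om ->
  positive_definite_kernel (closure Om) k ->
  Cclosure (2 * l) (square_rV Om) (uncurry_rV k) ->
  continuous (pde_fun p) -> continuous (bnd_fun p) ->
  (exists v : H, pde_solution p v) ->
  (forall n, [/\ finite_set (XO n), XO n !=set0 & XO n `<=` Om]) ->
  (forall n, [/\ finite_set (XB n), XB n !=set0 & XB n `<=` frontier Om]) ->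
  (forall n, lin_indep (collocation_functionals H p (XO n) (XB n))) ->
  effective_fill_distance Om (XO n) (XB n) @[n --> \oo] --> 0%E ->
  (forall n, or_minimizer p (XO n) (XB n) (u n)) ->
  (dist_to_set (u n) (min_norm_solutions H p) @[n --> \oo] --> 0%E) /\
  (forall ustar : H, min_norm_solutions H p = [set ustar] ->
     u n @[n --> \oo] --> ustar).
Proof.
move=> oOm _ _ kC cP cB [v vsol] XO_ XB_ _ fillX umin.
have XO2 n : XO n !=set0 /\ XO n `<=` Om by have [] := XO_ n.
have XB2 n : XB n !=set0 /\ XB n `<=` frontier Om by have [] := XB_ n.
have ultra F (UF : UltraFilter F) (ooF : \oo `<=` F) :=
  or_minimizers_cvg_ultra oOm kC UF ooF cP cB vsol XO2 XB2 fillX umin.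
split.
  apply: cvg_ultra => F UF ooF; have [w wS uw] := ultra F UF ooF.
  have FF : ProperFilter F by exact: ultra_proper.
  have uw0 : (`|u n - w|)%:E @[n --> F] --> 0%E.
    apply: cvg_EFin; first exact: nearW.
    have uww : `|u n - w| @[n --> F] --> `|w - w|.
      by apply: cvg_norm; apply: cvgB => //; exact: cvg_cst.
    by rewrite subrr normr0 in uww.
  apply: squeeze_cvge (cvg_cst 0%E) uw0; apply: nearW => n.
  apply/andP; split; last by apply: ereal_inf_lbound; exists w.
  by apply: le_ereal_inf_tmp => _ [s _ <-]; rewrite lee_fin.
move=> ustar Sstar; apply: cvg_ultra => F UF ooF.
by have [w] := ultra F UF ooF; rewrite Sstar => ->.
Qed.
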